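(* Let $G$ be a connected graph of order $n_1\ge 2$ and let $H$ be any non-complete graph of order $n_2$. Then $$g(G\odot H)\le s(G\odot H).$$
   Context: Graphs are finite, simple, with nonempty vertex set. The order of a graph is its number of vertices. $H$ need not be connected. Corona product: if $G$ has vertices $v_1,\dots,v_{n_1}$, then $G\odot H$ is obtained from one copy of $G$ and $n_1$ disjoint copies $H_1,\dots,H_{n_1}$ of $H$ by joining $v_i$ to every vertex of $H_i$, for each $i$. Geodetic number: in a connected graph $F$ with vertex set $V(F)$, $I_F[u,v]$ is the set of all vertices lying on some shortest $u$-$v$ path of $F$ (so $I_F[u,u]=\{u\}$), and $I_F[S]=\bigcup_{u,v\in S}I_F[u,v]$ for nonempty $S\subseteq V(F)$. $S$ is a geodetic set of $F$ if $I_F[S]=V(F)$. The geodetic number $g(F)$ is the minimum cardinality of a geodetic set of $F$. Steiner number: for nonempty $W\subseteq V(F)$, a Steiner $W$-tree is a connected subgraph of $F$ containing $W$ with the minimum possible number of edges (necessarily a tree). $S_F[W]$ is the set of all vertices of $F$ lying on some Steiner $W$-tree. $W$ is a Steiner set of $F$ if $S_F[W]=V(F)$. The Steiner number $s(F)$ is the minimum cardinality of a Steiner set of $F$. *)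

(* Defs.v *)
From mathcomp Require Import all_boot.

Set Implicit Arguments.
Unset Strict Implicit.
Unset Printing Implicit Defensive.

Record sgraph := SGraph {
  vertex :> finType;
  adj : rel vertex;
  adj_sym : symmetric adj;
  adj_irrefl : irreflexive adj }.

Definition connected_graph (F : sgraph) : Prop :=
  forall x y : F, connect (@adj F) x y.

Definition complete_graph (F : sgraph) : Prop :=
  forall x y : F, x != y -> adj x y.

Section Corona.
Variables G H : sgraph.

(* [inl v] is the vertex v of G and [inr (v, h)] is the vertex h of the copy *)
(* of H attached to v.                                                       *)
Definition corona_adj : rel (G + G * H)%type := fun a b =>
  match a, b with
  | inl v, inl w => adj v w
  | inl v, inr (w, _) => v == w
  | inr (v, _), inl w => v == w
  | inr (v, h), inr (w, k) => (v == w) && adj h k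
  end.

Lemma corona_adj_sym : symmetric corona_adj.
Proof.
by move=> [v|[v h]] [w|[w k]] //=; rewrite ?(eq_sym v) // adj_sym.
Qed.

Lemma corona_adj_irrefl : irreflexive corona_adj.
Proof. by move=> [v|[v h]] /=; rewrite adj_irrefl ?andbF. Qed.

Definition corona : sgraph := SGraph corona_adj_sym corona_adj_irrefl.

End Corona.

Section Geodetic.
Variable F : sgraph.

(* The path visits u followed by the vertices of p, so its length is size p. *)
Definition path_between (u v : F) (p : seq F) : bool :=
  [&& path (@adj F) u p, uniq (u :: p) & last u p == v].

(* As the vertices of a path are distinct, bounding the length of p and q by *)
(* #|F| is no restriction; it makes the quantifiers range over a finType.    *)
Definition shortest_path (u v : F) (p : seq F) : bool :=
  path_between u v p &&
  [forall q : #|F|.-bseq F, path_between u v q ==> (size p <= size q)].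

Definition interval (u v : F) : {set F} :=
  [set x | [exists p : #|F|.-bseq F, shortest_path u v p && (x \in u :: p)]].

Definition geodetic_closure (S : {set F}) : {set F} :=
  \bigcup_(u in S) \bigcup_(v in S) interval u v.

Definition geodetic_set (S : {set F}) : bool :=
  (S != set0) && (geodetic_closure S == [set: F]).

(* The whole vertex set is geodetic as soon as F is nonempty, so the default *)
(* of the minimum is harmless.                                               *)
Definition geodetic_number : nat :=
  #|[arg min_(S < [set: F] | geodetic_set S) #|S|]|.

End Geodetic.

Section Steiner.
Variable F : sgraph.

Definition edges : {set {set F}} :=
  [set [set x; y] | x in F, y in adj x].

(* A subgraph is given by its vertex set U and its edge set D. *)
Definition is_subgraph (U : {set F}) (D : {set {set F}}) : bool :=
  (D \subset edges) && (cover D \subset U).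

Definition connected_subgraph (U : {set F}) (D : {set {set F}}) : bool :=
  is_subgraph U D &&
  [forall x in U, forall y in U,
     connect (fun a b : F => [set a; b] \in D) x y].

Definition steiner_tree (W U : {set F}) (D : {set {set F}}) : bool :=
  [&& connected_subgraph U D, W \subset U &
      [forall U' : {set F}, forall D' : {set {set F}},
         connected_subgraph U' D' && (W \subset U') ==> (#|D| <= #|D'|)]].

Definition steiner_closure (W : {set F}) : {set F} :=
  [set x | [exists U : {set F}, exists D : {set {set F}},
              steiner_tree W U D && (x \in U)]].

Definition steiner_set (W : {set F}) : bool :=
  (W != set0) && (steiner_closure W == [set: F]).

(* The whole vertex set is a Steiner set as soon as F is nonempty and        *)
(* connected, so the default of the minimum is then harmless.                *)
Definition steiner_number : nat :=
  #|[arg min_(W < [set: F] | steiner_set W) #|W|]|.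

End Steiner.

(* Main.v *)
(** Let W be a Steiner set of the corona and (U, D) a Steiner W-tree containing
    a vertex x of the copy of H at v.  If v is in U, then x is in W: every
    neighbour of x other than v is a neighbour of v, so in the tree rooted at v
    the children of x can be reattached to v and x deleted.  As v separates its
    copy of H from the rest, v is indeed in U once W meets the outside of that
    copy; and W cannot lie within one copy, for then no vertex of another copy
    could be on a Steiner tree.  Hence W contains every vertex of every copy
    of H, and these vertices already form a geodetic set, v being on a geodesic
    between two nonadjacent vertices of its copy. *)

Require Import Defs.
From mathcomp Require Import all_boot.

Set Implicit Arguments.
Unset Strict Implicit.
Unset Printing Implicit Defensive.

(** * Reachability and spanning trees of finite relations *)

Lemma connect_invariant (T : finType) (e : rel T) (P : pred T) (x y : T) :
  (forall a b, P a -> e a b -> P b) -> P x -> connect e x y -> P y.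
Proof.
move=> stepP Px /connectP[p + ->].
elim: p x Px => //= a p IHp x Px /andP[e_xa]; apply: IHp.
exact: stepP Px e_xa.
Qed.

(** Breadth-first search from [z]: [depth] is the length of a shortest walk from [z], and the vertex
    before the last one on such a walk is a valid parent. *)
Lemma connect_parent (T : finType) (e : rel T) (z : T) :
  exists (parent : T -> T) (depth : T -> nat), forall u,
    connect e z u -> u != z ->
    e (parent u) u /\ depth (parent u) < depth u.
Proof.
pose walk u n := [exists t : n.-tuple T, path e z t && (last z t == u)].
have walkP u p : path e z p -> last z p = u -> walk u (size p).
  by move=> e_p z_p; apply/existsP; exists (in_tuple p); rewrite e_p z_p /=.
(* The second disjunct makes [ex_minn] applicable to every [u]; unreachable vertices get the junk
   depth 0. *)
have ex_walk u : exists n, walk u n || ~~ connect e z u.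
  have [/connectP[p e_p ->]|_] := boolP (connect e z u).
    by exists (size p); rewrite orbF; apply: walkP.
  by exists 0; rewrite orbT.
pose depth u := ex_minn (ex_walk u).
exists (fun u => odflt u [pick w | e w u && (depth w < depth u)]), depth.
move=> u z_u neq_uz; case: pickP => [w /andP[] //|no_parent].
have: walk u (depth u).
  by rewrite /depth; case: ex_minnP => n; rewrite z_u orbF.
case/existsP=> t; have := size_tuple t.
case/lastP: (tval t) => [|p w]; first by rewrite /= eq_sym (negPf neq_uz).
rewrite size_rcons rcons_path last_rcons => size_p.
case/andP=> /andP[e_p e_pw] /eqP eq_wu.
have := no_parent (last z p); rewrite -{1}eq_wu e_pw -size_p ltnS /=.
by rewrite {1}/depth; case: ex_minnP => n _ ->//; rewrite walkP.
Qed.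

(** * Subgraphs and Steiner trees *)

Section Subgraphs.
Variable F : sgraph.
Implicit Types (U W : {set F}) (D : {set {set F}}) (x y z : F).

Lemma mem_edges x y : ([set x; y] \in edges F) = adj x y.
Proof.
apply/imset2P/idP => [[a b _ b_adj_a eq_xy]|]; last by exists x y.
have adj_ab : adj a b := b_adj_a.
have neq_ab : a != b by apply: contraTneq adj_ab => ->; rewrite adj_irrefl.
have: a \in [set x; y] by rewrite eq_xy set21.
have: b \in [set x; y] by rewrite eq_xy set22.
rewrite !inE => /orP[] /eqP eq_b /orP[] /eqP eq_a;
  move: adj_ab neq_ab {b_adj_a eq_xy}; by rewrite eq_a eq_b ?eqxx // adj_sym.
Qed.

Lemma subgraph_edge U D x y :
  is_subgraph U D -> [set x; y] \in D -> [/\ adj x y, x \in U & y \in U].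
Proof.
case/andP=> /subsetP sDE /subsetP sDU xyD; rewrite -mem_edges sDE //.
by split=> //; apply: sDU; apply/bigcupP; exists [set x; y]; rewrite ?set21 ?set22.
Qed.

Lemma edge_rel_sym D : symmetric (fun a b : F => [set a; b] \in D).
Proof. by move=> a b; rewrite setUC. Qed.

(** If [x] were outside [W], handing its children over to [z] would give a smaller connected
    subgraph containing [W]. That [D] is a tree is never established: counting parent edges bounds
    its size from below. *)
Lemma steiner_tree_dominated W U D x z :
  x != z -> (forall y, adj x y -> y != z -> adj z y) ->
  steiner_tree W U D -> x \in U -> z \in U -> x \in W.
Proof.
move=> neq_xz dom /and3P[/andP[sub_UD conn_UD] sWU minD] xU zU.
apply: contraLR minD => xW; rewrite negb_forall.
pose e D0 := fun a b : F => [set a; b] \in D0.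
have conn a : a \in U -> connect (e D) z a.
  by move=> aU; move/forall_inP/(_ z zU)/forall_inP: conn_UD; apply.
have [parent [depth parentP]] := connect_parent (e D) z.
have parentE u : u \in U -> u != z ->
    [/\ adj (parent u) u, parent u \in U, [set parent u; u] \in D
      & depth (parent u) < depth u].
  move=> uU neq_uz; have [puD lt_pu] := parentP u (conn u uU) neq_uz.
  by have [] := subgraph_edge sub_UD puD.
(* Distinct vertices have distinct parent edges: otherwise each would be the parent of the other,
   which the depths forbid. *)
have leUD : #|U :\ z| <= #|D|.
  rewrite -(@card_in_imset _ _ (fun u => [set parent u; u])).
    apply/subset_leq_card/subsetP => _ /imsetP[u + ->]; rewrite !inE.
    by case/andP=> neq_uz uU; have [] := parentE u uU neq_uz.
  move=> u w; rewrite !inE => /andP[neq_uz uU] /andP[neq_wz wU] /= eq_uw.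
  have [_ _ _ lt_u] := parentE u uU neq_uz.
  have [_ _ _ lt_w] := parentE w wU neq_wz.
  have: u \in [set parent w; w] by rewrite -eq_uw set22.
  have: w \in [set parent u; u] by rewrite eq_uw set22.
  rewrite !inE => /orP[/eqP eq_w|/eqP-> //] /orP[/eqP eq_u|/eqP //].
  by rewrite -eq_w in lt_u; rewrite -eq_u ltnNge ltnW in lt_w.
pose parent' u := if parent u == x then z else parent u.
have parent'E u : u \in U -> u != z ->
    adj (parent' u) u && (parent' u \in U :\ x).
  move=> uU neq_uz; have [adj_pu pU _ _] := parentE u uU neq_uz.
  rewrite /parent'; have [eq_px|neq_px] := eqVneq (parent u) x.
    by rewrite !inE eq_sym neq_xz zU dom // -eq_px.
  by rewrite !inE adj_pu neq_px.
(* One edge for each vertex of [U] other than [z] and [x], so at most [#|U| - 2] edges, below the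
   bound [#|U| - 1 <= #|D|]. *)
pose D' := [set [set parent' u; u] | u in U :\ z :\ x].
apply/existsP; exists (U :\ x); rewrite negb_forall; apply/existsP; exists D'.
rewrite negb_imply -ltnNge; apply/andP; split; last first.
  apply: leq_ltn_trans (leq_imset_card _ _) (leq_trans _ leUD).
  by rewrite [in X in _ <= X](cardsD1 x) !inE neq_xz xU.
have sub_UD' : is_subgraph (U :\ x) D'.
  apply/andP; split; apply/subsetP.
    move=> _ /imsetP[u + ->]; rewrite !inE => /and3P[_ neq_uz uU].
    by rewrite mem_edges; have /andP[] := parent'E u uU neq_uz.
  move=> a /bigcupP[_ /imsetP[u + ->]]; rewrite !inE => /and3P[neq_ux neq_uz uU].
  have /andP[_] := parent'E u uU neq_uz; rewrite !inE => p'U.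
  by case/orP=> /eqP-> //; rewrite neq_ux.
(* The old depth still serves for induction: [parent' u] is either the root [z] or the old parent,
   of smaller depth. *)
have conn' n u : depth u < n -> u \in U :\ x -> connect (e D') z u.
  elim: n u => // n IHn u; rewrite ltnS => le_un.
  rewrite !inE => /andP[neq_ux uU].
  have [-> //|neq_uz] := eqVneq u z.
  have [_ pU _ lt_pu] := parentE u uU neq_uz.
  apply: (connect_trans (y := parent' u)).
    rewrite /parent'; have [//|neq_px] := eqVneq (parent u) x.
    by apply: IHn; rewrite ?(leq_trans lt_pu) // !inE neq_px.
  by apply/connect1/imsetP; exists u => //; rewrite !inE neq_ux neq_uz.
apply/andP; split; last first.
  apply/subsetP=> w wW; rewrite !inE (subsetP sWU) // andbT.
  by apply: contraNneq xW => <-.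
apply/andP; split=> //; apply/forall_inP=> a aU; apply/forall_inP=> b bU.
apply: (connect_trans (y := z)); last exact: conn' bU.
rewrite (sym_connect_sym (edge_rel_sym D')); exact: conn' aU.
Qed.

(** A smallest edge set connecting all vertices is a Steiner tree through every vertex. This
    validates the default of the minimum in [steiner_number]. *)
Lemma steiner_setT : 0 < #|F| -> connected_graph F -> steiner_set [set: F].
Proof.
move=> F_gt0 F_conn; apply/andP; split; first by rewrite -cards_eq0 cardsT -lt0n.
pose P (D : {set {set F}}) := connected_subgraph [set: F] D.
have P_edges : P (edges F).
  rewrite /P /connected_subgraph /is_subgraph subxx subsetT /=.
  apply/forall_inP=> a _; apply/forall_inP=> b _.
  by rewrite (eq_connect (@mem_edges)) F_conn.
case: (arg_minnP (fun D : {set {set F}} => #|D|) P_edges) => D PD minD.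
rewrite eqEsubset subsetT /=; apply/subsetP=> x _; rewrite inE.
apply/existsP; exists [set: F]; apply/existsP; exists D; rewrite inE andbT.
apply/and3P; split=> //.
apply/forallP=> U'; apply/forallP=> D'; apply/implyP=> /andP[UD'].
by rewrite subTset => /eqP eqU'; rewrite minD // /P -eqU'.
Qed.

End Subgraphs.

(** * Geodesics and geodetic sets *)

Section Geodesics.
Variable F : sgraph.
Implicit Types (S : {set F}) (x y z : F).

Lemma interval_refl x : x \in interval x x.
Proof.
rewrite inE; apply/existsP; exists [bseq]; rewrite /= mem_head andbT.
apply/andP; split; first by rewrite /path_between /= eqxx.
by apply/forallP=> q; apply/implyP.
Qed.

Lemma interval_common_neighbour x y z :
  x != y -> ~~ adj x y -> adj x z -> adj z y -> z \in interval x y.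
Proof.
move=> neq_xy nadj_xy adj_xz adj_zy.
have neq_xz : x != z by apply: contraTneq adj_xz => ->; rewrite adj_irrefl.
have neq_zy : z != y by apply: contraTneq adj_zy => ->; rewrite adj_irrefl.
have uniq_xzy : uniq [:: x; z; y].
  by rewrite /= !inE negb_or neq_xz neq_xy neq_zy.
have size_p : size [:: z; y] <= #|F|.
  by apply: leq_trans (max_card [in [:: x; z; y]]); rewrite (card_uniqP uniq_xzy).
rewrite inE; apply/existsP; exists (Bseq size_p); rewrite /= !inE eqxx orbT andbT.
apply/andP; split; first by rewrite /path_between uniq_xzy /= adj_xz adj_zy eqxx.
(* Only lengths 0 and 1 could beat the path through [z]; they would force [x = y] or [adj x y]. *)
apply/forallP=> q; apply/implyP; case: q => [[|a [|b q]] //= _].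
  by rewrite /path_between /= (negPf neq_xy).
case/and3P=> /= /andP[adj_xa _] _ /eqP eq_ay.
by rewrite -eq_ay adj_xa in nadj_xy.
Qed.

Lemma geodetic_setP S :
  S != set0 ->
  (forall x, exists y z, [/\ y \in S, z \in S & x \in interval y z]) ->
  geodetic_set S.
Proof.
move=> S_neq0 coverS; rewrite /geodetic_set S_neq0 eqEsubset subsetT /=.
apply/subsetP=> x _; have [y [z [yS zS xyz]]] := coverS x.
by apply/bigcupP; exists y => //; apply/bigcupP; exists z.
Qed.

Lemma geodetic_number_le S : geodetic_set S -> geodetic_number F <= #|S|.
Proof.
move=> gS; rewrite /geodetic_number.
(* Needed for the default of the minimum; nonemptiness of [F] comes from [S]. *)
have gT : geodetic_set [set: F].
  apply: geodetic_setP => [|x]; last first.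
    by exists x, x; split; rewrite ?in_setT ?interval_refl.
  by case/andP: gS => /set0Pn[x _] _; apply/set0Pn; exists x; rewrite inE.
by case: (arg_minnP (fun A : {set F} => #|A|) gT) => A _; apply.
Qed.

End Geodesics.

(** * Steiner and geodetic sets of the corona *)

Section Corona.
Variables G H : sgraph.
Local Notation F := (corona G H).

Definition in_copy (v : G) : pred F :=
  fun a => if a is inr (w, _) then w == v else false.

Lemma corona_connected : connected_graph G -> connected_graph F.
Proof.
move=> G_conn.
have base (v w : G) : connect (@adj F) (inl v) (inl w).
  pose P (a : G) := connect (@adj F) (inl v) (inl a).
  apply: (@connect_invariant _ (@adj G) P) (G_conn v w); last exact: connect0.
  by move=> a b Pa adj_ab; apply: connect_trans Pa (connect1 _).
pose root (a : F) : G := match a with inl v => v | inr (v, _) => v end.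
have to_root a : connect (@adj F) (inl (root a)) a.
  by case: a => [v|[v h]] //=; apply: connect1; rewrite /= eqxx.
move=> a b; apply: connect_trans (to_root b).
apply: connect_trans (base (root a) (root b)).
by rewrite (sym_connect_sym (@adj_sym F)).
Qed.

(** The only edges leaving the copy at [v] end in [inl v]; without that vertex, membership in the
    copy is invariant along the edges of [D]. *)
Lemma copy_exit (U : {set F}) D v x y :
  connected_subgraph U D -> x \in U -> in_copy v x ->
  y \in U -> ~~ in_copy v y -> (inl v : F) \in U.
Proof.
case/andP=> sub_UD /forall_inP conn_UD xU vx yU; apply: contraNT => vU.
have /forall_inP/(_ y yU) := conn_UD x xU.
apply: connect_invariant vx => a b va abD.
have [adj_ab _ bU] := subgraph_edge sub_UD abD.
move: a b va adj_ab bU {abD} => [//|[w h]] [w'|[w' k]] /= /eqP->.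
  by move/eqP<- => bU; rewrite bU in vU.
by case/andP=> /eqP->.
Qed.

Lemma steiner_tree_copy W (U : {set F}) D v h y :
  steiner_tree W U D -> (inr (v, h) : F) \in U ->
  y \in W -> ~~ in_copy v y -> (inr (v, h) : F) \in W.
Proof.
move=> treeU xU yW vy; have /and3P[conn_UD /subsetP sWU _] := treeU.
have vU : (inl v : F) \in U by apply: copy_exit conn_UD xU _ (sWU y yW) vy => /=.
apply: steiner_tree_dominated treeU xU vU => // [[w|[w k]]] /=.
  by move/eqP->; rewrite eqxx.
by case/andP.
Qed.

Lemma steiner_set_copies (W : {set F}) v h :
  2 <= #|G| -> steiner_set W -> (inr (v, h) : F) \in W.
Proof.
move=> G_order /andP[/set0Pn[y yW] /eqP W_steiner].
have step w k a : a \in W -> ~~ in_copy w a -> (inr (w, k) : F) \in W.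
  have : (inr (w, k) : F) \in steiner_closure W by rewrite W_steiner inE.
  rewrite inE => /existsP[U /existsP[D /andP[treeU xU]]].
  exact: steiner_tree_copy treeU xU.
(* If [y] lies in the copy at [v], it lies outside the copy at some other [w]. This puts a vertex of
   the copy at [w] into [W], and that vertex is outside the copy at [v]. *)
have [vy|] := boolP (in_copy v y); last exact: step yW.
have [w neq_wv] : exists w, w != v.
  by have /card_gt1P[a [b [_ _]]] := G_order;
    have [->|] := eqVneq a v; [exists b; rewrite eq_sym | exists a].
have /step : (inr (w, h) : F) \in W; last by apply.
by apply: step yW _; case: y vy => [|[a k]] //= /eqP->; rewrite eq_sym.
Qed.

Definition copies : {set F} := [set inr p | p in [set: G * H]].

Lemma geodetic_copies :
  0 < #|G| -> ~ complete_graph H -> geodetic_set copies.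
Proof.
move=> /card_gt0P[v0 _] H_noncomplete.
have in_copies p : (inr p : F) \in copies by apply: imset_f; rewrite inE.
(* Finiteness of [H] makes completeness decidable, so its negation yields a witness pair. *)
have [h [k [neq_hk nadj_hk]]] : exists h k : H, h != k /\ ~~ adj h k.
  have [/existsP[h /existsP[k /andP[]]]|/existsPn none] :=
    boolP [exists h : H, exists k, (h != k) && ~~ adj h k]; first by exists h, k.
  case: H_noncomplete => h k neq_hk; have /existsPn/(_ k) := none h.
  by rewrite neq_hk negbK.
apply: geodetic_setP => [|[v|p]]; first by apply/set0Pn; exists (inr (v0, h)).
- exists (inr (v, h)), (inr (v, k)); split=> //.
  apply: interval_common_neighbour; rewrite /= ?eqxx //.
  by apply: contraNneq neq_hk => [[->]].
- by exists (inr p), (inr p); split=> //; apply: interval_refl.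
Qed.

End Corona.

Theorem theorem24 (G H : sgraph)
  (G_conn : connected_graph G) (G_order : 2 <= #|G|)
  (H_noncomplete : ~ complete_graph H) :
  geodetic_number (corona G H) <= steiner_number (corona G H).
Proof.
have G_gt0 : 0 < #|G| by apply: ltnW.
apply: leq_trans (geodetic_number_le (geodetic_copies G_gt0 H_noncomplete)) _.
have F_gt0 : 0 < #|corona G H|.
  by have /card_gt0P[v _] := G_gt0; apply/card_gt0P; exists (inl v).
have sT := steiner_setT F_gt0 (corona_connected (H := H) G_conn).
rewrite /steiner_number.
case: (arg_minnP (fun A : {set corona G H} => #|A|) sT) => W sW _.
apply/subset_leq_card/subsetP => _ /imsetP[[v h] _ ->].
exact: steiner_set_copies.
Qed.
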